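(* Let $X$ be a non-empty compact subset of $\mathbb{R}^n$, where $\mathbb{R}^n$ has the metric induced by the $1$-norm $\|\cdot\|_1$. For $1 \le s \le n$, let $P_s\colon \mathbb{R}^n \to \mathbb{R}$ be defined by $P_s\bigl((x_1,\dots,x_n)\bigr) = x_s$ for all $(x_1,\dots,x_n) \in \mathbb{R}^n$. Then (1) $\displaystyle M(X) \le \frac{1}{2}\sum_{s=1}^n D(P_s(X))$, and (2) $\displaystyle M(X) \le \frac{n\,D(X)}{2}$.
   Context: For a compact metric space $(X,d)$, $D(X)$ denotes its metric diameter, and $M(X) = \sup_\mu \int_X\int_X d(x,y)\,d\mu(x)\,d\mu(y)$, where $\mu$ ranges over all finite signed Borel measures on $X$ of total mass $1$. Subsets of $\mathbb{R}$ carry the usual metric $|x-y|$. *)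

(* Defs.v *)
From HB Require Import structures.
From mathcomp Require Import all_boot all_order all_algebra.
From mathcomp Require Import all_classical all_reals all_analysis.

Set Implicit Arguments.
Unset Strict Implicit.
Unset Printing Implicit Defensive.

Import Order.TTheory GRing.Theory Num.Theory.
Import numFieldNormedType.Exports.

Local Open Scope classical_set_scope.
Local Open Scope ring_scope.

(* The carrier [T] with its Borel sigma-algebra. The library only defines
   measurable structures on pointed types, and [set_type X] is not one, so a
   base point is part of the type; nothing else depends on it. *)
Definition borel_type {T : Type} (x0 : T) : Type := T.

Section borel_type_instance.
Variables (T : topologicalType) (x0 : T).

Let borel_setC (A : set T) : <<s @open T >> A -> <<s @open T >> (~` A).
Proof. by move=> sA; rewrite -setTD; exact: sigma_algebraCD. Qed.

HB.instance Definition _ := Choice.on (borel_type x0).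
HB.instance Definition _ := isPointed.Build (borel_type x0) x0.
HB.instance Definition _ := @isMeasurable.Build (sigma_display (@open T))
  (borel_type x0) <<s @open T >> (@sigma_algebra0 _ setT _) borel_setC
  (@sigma_algebra_bigcup _ setT _).

End borel_type_instance.

Section set_type_metric.
Context {R : realType} {T : metricType R} (X : set T).

Definition set_type_mdist (x y : X) : R := mdist (set_val x) (set_val y).

Let set_type_mdist_ge0 (x y : X) : 0 <= set_type_mdist x y.
Proof. exact: mdist_ge0. Qed.

Let set_type_mdist_positivity (x y : X) : set_type_mdist x y = 0 -> x = y.
Proof. by move=> /mdist_positivity; exact: val_inj. Qed.

Let set_type_ballEmdist (x : X) (d : R) :
  ball x d = [set y | set_type_mdist x y < d].
Proof.
rewrite -[LHS]/((set_val : X -> T) @^-1` ball (set_val x) d).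
by rewrite ballEmdist.
Qed.

HB.instance Definition _ := @PseudoMetric_isMetric.Build R (X : Type)
  set_type_mdist set_type_mdist_ge0 set_type_mdist_positivity
  set_type_ballEmdist.

End set_type_metric.

(* R^n with the metric (hence topology) induced by the 1-norm, as opposed to
   the max norm that ['rV[R]_n] carries. *)
Definition l1_space (R : realType) (n : nat) : Type := 'rV[R]_n.

Section l1_space_metric.
Context {R : realType} {n : nat}.

Definition norm1 (x : 'rV[R]_n) : R := \sum_(s < n) `|x ord0 s|.

Definition l1_mdist (x y : l1_space R n) : R :=
  norm1 ((x : 'rV[R]_n) - (y : 'rV[R]_n)).

Let l1_mdistxx (x : l1_space R n) : l1_mdist x x = 0.
Proof.
by rewrite /l1_mdist /norm1 subrr big1 // => s _; rewrite mxE normr0.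
Qed.

Let l1_mdist_positivity (x y : l1_space R n) : l1_mdist x y = 0 -> x = y.
Proof.
move=> /psumr_eq0P xy; apply/rowP => s; apply/eqP; rewrite -subr_eq0.
by rewrite -normr_eq0 -(xy (fun _ _ => normr_ge0 _) s isT) !mxE.
Qed.

Let l1_mdist_sym (x y : l1_space R n) : l1_mdist x y = l1_mdist y x.
Proof. by apply: eq_bigr => s _; rewrite !mxE distrC. Qed.

Let l1_mdist_triangle (y x z : l1_space R n) :
  l1_mdist x z <= l1_mdist x y + l1_mdist y z.
Proof.
rewrite /l1_mdist /norm1 -big_split /=; apply: ler_sum => s _.
by rewrite !mxE; exact: ler_distD.
Qed.

HB.instance Definition _ := Choice.copy (l1_space R n) 'rV[R]_n.
HB.instance Definition _ := @isMetric.Build R (l1_space R n)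
  l1_mdist l1_mdistxx l1_mdist_positivity l1_mdist_sym l1_mdist_triangle.

(* The library puts the metric |y - x| on [R^o]. *)
Definition coord_proj (s : 'I_n) (x : l1_space R n) : R^o :=
  (x : 'rV[R]_n) ord0 s.

End l1_space_metric.

Local Open Scope ereal_scope.

Section charge_integral.
Context d (T : measurableType d) (R : realType).
Variable mu : {charge set T -> \bar R}.

Lemma ex_hahn_decomposition : exists PN, hahn_decomposition mu PN.1 PN.2.
Proof. by have [P [N PN]] := Hahn_decomposition mu; exists (P, N). Qed.

Definition chosen_hahn := cid ex_hahn_decomposition.

(* The Jordan decomposition, hence this integral, does not depend on the Hahn
   decomposition that is chosen: see [Hahn_decomposition_uniq]. *)
Definition charge_integral (f : T -> \bar R) : \bar R :=
  \int[jordan_pos (projT2 chosen_hahn)]_x f x -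
  \int[jordan_neg (projT2 chosen_hahn)]_x f x.

End charge_integral.

Section metric_invariants.
Context {R : realType}.

Definition metric_diam (X : metricType R) : \bar R :=
  ereal_sup [set (mdist p.1 p.2)%:E | p in [set: X * X]].

Definition energy (X : metricType R) (x0 : X)
    (mu : {charge set (borel_type x0) -> \bar R}) : \bar R :=
  charge_integral mu
    (fun y : X => charge_integral mu (fun x : X => (mdist x y)%:E)).

(* The supremum runs over all signed Borel measures of total mass 1; the
   existential on [x0] only makes [borel_type x0] a type (there is no measure
   of mass 1 on an empty space anyway). *)
Definition metric_M (X : metricType R) : \bar R :=
  ereal_sup [set e | exists (x0 : X)
    (mu : {charge set (borel_type x0) -> \bar R}),
    mu setT = 1 /\ e = energy mu].

End metric_invariants.

(* Main.v *)
(** For a cut [{x_s > t}], whose side [A] has [mu]-mass [F], the pseudometric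
[|1_A x - 1_A y|] has energy [2 F (1 - F) <= 1/2]. The distance [|x_s - y_s|]
is the integral of these cut pseudometrics over [t] in an interval of length
[D (P_s X)]. Instead of exchanging integrals, this integral over [t] is
replaced by a Riemann sum, which approximates [|x_s - y_s|] uniformly up to the
mesh; since the total variation of [mu] is finite, the error in the energy
vanishes with the mesh. *)
Require Import Defs.
From HB Require Import structures.
From mathcomp Require Import all_boot all_order all_algebra.
From mathcomp Require Import ring lra.
From mathcomp Require Import all_classical all_reals all_analysis.
From mathcomp Require Import measurable_realfun.
Set Implicit Arguments.
Unset Strict Implicit.
Unset Printing Implicit Defensive.
Import Order.TTheory GRing.Theory Num.Theory.
Import numFieldNormedType.Exports.
Local Open Scope classical_set_scope.
Local Open Scope ring_scope.

(** * Riemann sums approximating the distance on a line *)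

Section staircase.
Context {R : realFieldType}.
Implicit Types (a w u v : R) (m : nat).

(** Riemann sum of mesh [w] for the indicator of [t < u] over [[a, a + m w]]. *)
Definition staircase a w m u : R := \sum_(k < m) w * (a + k%:R * w < u)%R%:R.

(** Up to the cap [m w], the sum rounds [u - a] up to a multiple of [w]. Keeping the cap in both
    bounds lets the induction on [m] go through. *)
Lemma staircase_bounds a w m u : 0 <= w -> a <= u ->
  Num.min (u - a) (m%:R * w) <= staircase a w m u <=
  Num.min (u - a + w) (m%:R * w).
Proof.
move=> w0 au; elim: m => [|m]; rewrite /staircase.
  by rewrite big_ord0 mul0r !ge_min le_min lexx orbT /=; lra.
rewrite big_ord_recr /=; set S := \sum_(k < m) _ => /andP[lb ub].
rewrite -natr1 mulrDl mul1r; move: lb ub; rewrite !ge_min !le_min.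
move=> /orP lb /andP[ub1 ub2]; case: ltP => h; rewrite ?mulr1 ?mulr0.
  by apply/andP; split; [apply/orP; right; case: lb; lra|lra].
by apply/andP; split; [apply/orP; left; case: lb; lra|lra].
Qed.

(** For [u <= v] all the indicator differences have the same sign. *)
Lemma staircase_le a w m u v : 0 <= w -> u <= v ->
  staircase a w m v - staircase a w m u =
  \sum_(k < m) w * `|(a + k%:R * w < u)%R%:R - (a + k%:R * w < v)%R%:R|.
Proof.
move=> w0 uv; rewrite /staircase -sumrB; apply: eq_bigr => k _.
rewrite -mulrBr; congr (_ * _); case: ltP => hv; case: ltP => hu.
- by rewrite subrr normr0.
- by rewrite sub0r normrN normr1 subr0.
- by move: (lt_le_trans hu uv); rewrite ltNge hv.
- by rewrite subrr normr0.
Qed.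

(** Below the cap, each staircase overshoots by an amount between [0] and [w], so their difference
    is off by at most [w] rather than [2 w]. *)
Lemma staircase_dist a w m u v : 0 <= w ->
  a <= u <= a + m%:R * w -> a <= v <= a + m%:R * w ->
  `| `|u - v| - \sum_(k < m)
      w * `|(a + k%:R * w < u)%R%:R - (a + k%:R * w < v)%R%:R| | <= w.
Proof.
wlog uv : u v / u <= v => [h w0 hu hv|].
  case/orP: (le_total u v) => uv; first exact: h.
  rewrite (distrC u) (eq_bigr (fun k : 'I_m =>
    w * `|(a + k%:R * w < v)%R%:R - (a + k%:R * w < u)%R%:R|)); last first.
    by move=> k _; rewrite distrC.
  exact: h.
move=> w0 /andP[au ub] /andP[av vb]; rewrite -staircase_le//.
have := staircase_bounds m w0 au; have := staircase_bounds m w0 av.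
rewrite !ge_min !le_min => /andP[/orP hv1 /andP[hv2 hv3]].
move=> /andP[/orP hu1 /andP[hu2 hu3]].
rewrite (distrC u) (ger0_norm (_ : 0 <= v - u)) ?subr_ge0// ler_norml.
by apply/andP; split; case: hv1; case: hu1; lra.
Qed.

End staircase.

(** * Integration of bounded functions against a signed measure *)

Section signed_integral.
Context d (T : measurableType d) (R : realType).
Implicit Types (f g : T -> R) (A : set T).

Definition bounded_measurable f :=
  measurable_fun setT f /\ exists M, forall x, `|f x| <= M.

Lemma bounded_measurable_cst (r : R) : bounded_measurable (cst r).
Proof. by split; [exact: measurable_cst|exists `|r|]. Qed.

Lemma bounded_measurable_indic A : measurable A -> bounded_measurable \1_A.
Proof.
split; first exact: measurable_indic.
by exists 1 => x; rewrite indicE; case: (x \in A); rewrite ?normr1 ?normr0.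
Qed.

Lemma bounded_measurableD f g : bounded_measurable f ->
  bounded_measurable g -> bounded_measurable (fun x => f x + g x).
Proof.
move=> [mf [M fM]] [mg [N gN]]; split; first exact: measurable_funD.
by exists (M + N) => x; exact: le_trans (ler_normD _ _) (lerD _ _).
Qed.

Lemma bounded_measurableZ (r : R) f : bounded_measurable f ->
  bounded_measurable (fun x => r * f x).
Proof.
move=> [mf [M fM]]; split; first exact: measurable_funM.
by exists (`|r| * M) => x; rewrite normrM ler_wpM2l.
Qed.

Lemma bounded_measurable_sum (I : Type) (s : seq I) (F : I -> T -> R) :
  (forall i, bounded_measurable (F i)) ->
  bounded_measurable (fun x => \sum_(i <- s) F i x).
Proof.
move=> bF; elim: s => [|i s ih].
  by under eq_fun do rewrite big_nil; exact: bounded_measurable_cst.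
by under eq_fun do rewrite big_cons; exact: bounded_measurableD.
Qed.

Lemma bounded_measurable_integrable (nu : {finite_measure set T -> \bar R}) f :
  bounded_measurable f -> nu.-integrable setT (EFin \o f).
Proof.
move=> [mf [M fM]]; apply: measurable_bounded_integrable => //.
  by rewrite ltey_eq fin_num_measure.
exists M; split; first exact: num_real.
by move=> x Mx y _ /=; exact: le_trans (ltW Mx).
Qed.

Variable mu : {charge set T -> \bar R}.
Let mu_pos : {finite_measure set T -> \bar R} :=
  jordan_pos (projT2 (chosen_hahn mu)).
Let mu_neg : {finite_measure set T -> \bar R} :=
  jordan_neg (projT2 (chosen_hahn mu)).

Definition signed_integral f : R :=
  (\int[mu_pos]_x f x - \int[mu_neg]_x f x)%R.

(** The total variation of [mu]. *)
Definition mass_variation : R := fine (mu_pos setT) + fine (mu_neg setT).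

(** Both Jordan parts are finite measures, so no [+oo - +oo] can arise. *)
Lemma charge_integralE f : bounded_measurable f ->
  charge_integral mu (EFin \o f) = (signed_integral f)%:E.
Proof.
move=> bf; rewrite EFinB !fineK//.
- exact: integrable_fin_num (bounded_measurable_integrable mu_neg bf).
- exact: integrable_fin_num (bounded_measurable_integrable mu_pos bf).
Qed.

Lemma signed_integralD f g : bounded_measurable f -> bounded_measurable g ->
  signed_integral (fun x => f x + g x) = signed_integral f + signed_integral g.
Proof.
move=> bf bg; rewrite /signed_integral !RintegralD//;
  try exact: bounded_measurable_integrable.
by rewrite opprD addrACA.
Qed.

Lemma signed_integralZ (r : R) f : bounded_measurable f ->
  signed_integral (fun x => r * f x) = r * signed_integral f.
Proof.
move=> bf; rewrite /signed_integral !RintegralZl ?mulrBr//;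
  exact: bounded_measurable_integrable.
Qed.

Lemma signed_integral_indic A : measurable A ->
  signed_integral \1_A = fine (mu A).
Proof.
move=> mA; rewrite /signed_integral /Rintegral !integral_indic// !setIT.
rewrite (jordan_decomp (projT2 (chosen_hahn mu)) mA) /cadd/= cscaleN1.
by rewrite fineD ?fin_numN ?fin_num_measure// fineN.
Qed.

Lemma signed_integral_cst (r : R) :
  signed_integral (cst r) = r * fine (mu setT).
Proof.
rewrite -signed_integral_indic// -signed_integralZ.
  by congr signed_integral; apply/funext => x; rewrite indicT mulr1.
exact: bounded_measurable_indic.
Qed.

Lemma signed_integral_sum (I : Type) (s : seq I) (F : I -> T -> R) :
  (forall i, bounded_measurable (F i)) ->
  signed_integral (fun x => \sum_(i <- s) F i x) =
  \sum_(i <- s) signed_integral (F i).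
Proof.
move=> bF; elim: s => [|i s ih].
  rewrite big_nil; under eq_fun do rewrite big_nil.
  by rewrite (signed_integral_cst 0) mul0r.
rewrite big_cons -ih -signed_integralD//; last exact: bounded_measurable_sum.
by congr signed_integral; apply/funext => x; rewrite big_cons.
Qed.

(** Each Jordan part contributes at most [M] times its own mass. *)
Lemma signed_integral_le f (M : R) : bounded_measurable f ->
  (forall x, `|f x| <= M) -> `|signed_integral f| <= M * mass_variation.
Proof.
move=> bf fM; rewrite mulrDr (le_trans (ler_normB _ _))//.
have le_nu (nu : {finite_measure set T -> \bar R}) :
    `|\int[nu]_x f x|%R <= M * fine (nu setT).
  have i_f := bounded_measurable_integrable nu bf.
  rewrite -Rintegral_cst// (le_trans (le_normr_Rintegral _ i_f))//.
  apply: le_Rintegral => //.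
  - exact: integrable_norm i_f.
  - exact: bounded_measurable_integrable (bounded_measurable_cst M).
by rewrite lerD.
Qed.

End signed_integral.

(** * Borel measurability of Lipschitz functions *)

Lemma lipschitz_measurable (R : realType) (X : metricType R) (x0 : X)
    (f : X -> R) (K : R) : (forall x y, `|f x - f y| <= K * mdist x y) ->
  measurable_fun setT (f : borel_type x0 -> R).
Proof.
move=> fK; apply: (measurability _ (RGenOInfty.measurableE R)) => //.
move=> _ [_ [r ->] <-]; rewrite setTI; apply: sub_sigma_algebra.
suff : @open X [set x | f x \in `]r, +oo[] by [].
rewrite openE => x /=; rewrite in_itv/= andbT => rfx.
apply/nbhs_ballP; have K0 : 0 < `|K| + 1 by rewrite ltr_wpDl.
(* The [+ 1] keeps the denominator positive even for [K = 0]; within this radius [f] drops by less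
   than [f x - r]. *)
exists ((f x - r) / (`|K| + 1)) => /=; first by rewrite divr_gt0// subr_gt0.
move=> y; rewrite ballEmdist /= ltr_pdivlMr// in_itv/= andbT => xy.
have := fK x y; rewrite ler_norml => /andP[_ fxy].
have : K * mdist x y <= (`|K| + 1) * mdist x y.
  by rewrite ler_wpM2r ?mdist_ge0// (le_trans (ler_norm _))// lerDl.
by rewrite [_ * (`|K| + 1)]mulrC in xy; lra.
Qed.

(** * Energy of a metric approximated by weighted cuts *)

Section cut_energy.
Context {R : realType} {X : metricType R} {x0 : X}.
Variables (mu : {charge set (borel_type x0) -> \bar R}) (J : finType).
Variables (A : J -> set (borel_type x0)) (w : J -> R) (e : R).
Hypotheses (mA : forall j, measurable (A j)) (mu1 : mu setT = 1%E).

(** Both the cut sum in [x] for fixed [y] and its integral as a function of [y] have this shape. *)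
Lemma bounded_measurable_simple (b c : J -> R) : bounded_measurable
  (fun x : borel_type x0 => \sum_j w j * (b j + c j * \1_(A j) x)).
Proof.
apply: bounded_measurable_sum => j; apply/bounded_measurableZ.
apply: bounded_measurableD; first exact: bounded_measurable_cst.
by apply/bounded_measurableZ; exact: bounded_measurable_indic.
Qed.

(** Each constant [b j] integrates to itself because [mu] has mass 1. *)
Lemma signed_integral_simple (b c : J -> R) :
  signed_integral mu (fun x => \sum_j w j * (b j + c j * \1_(A j) x)) =
  \sum_j w j * (b j + c j * fine (mu (A j))).
Proof.
have bA j : bounded_measurable (fun x : borel_type x0 => c j * \1_(A j) x : R).
  by apply/bounded_measurableZ; exact: bounded_measurable_indic.
have bcA j : bounded_measurable 
    (fun x : borel_type x0 => b j + c j * \1_(A j) x).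
  by apply: bounded_measurableD => //; exact: bounded_measurable_cst.
rewrite signed_integral_sum; last first.
  by move=> j; exact (bounded_measurableZ (w j) (bcA j)).
apply: eq_bigr => j _; rewrite (signed_integralZ _ _ (bcA j)).
rewrite signed_integralD//; last exact: bounded_measurable_cst.
rewrite (signed_integral_cst mu (b j)) mu1 mulr1 signed_integralZ.
  by rewrite signed_integral_indic.
exact: bounded_measurable_indic.
Qed.

Hypotheses (w0 : forall j, 0 <= w j).
Hypothesis cut_approx : forall x y : X,
  `|mdist x y - \sum_j w j * `|\1_(A j) x - \1_(A j) y| | <= e.

(** For [a], [b] in [{0, 1}], [|a - b| = b + (1 - 2 b) a], which is affine in [a] and so integrates
    termwise. *)
Lemma cutE (x y : X) :
  \sum_j w j * `|\1_(A j) x - \1_(A j) y| =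
  \sum_j w j * (\1_(A j) y + (1 - 2 * \1_(A j) y) * \1_(A j) x) :> R.
Proof.
apply: eq_bigr => j _; congr (_ * _); rewrite !indicE.
by case: (_ \in _); case: (_ \in _) => /=;
  rewrite ?subrr ?subr0 ?sub0r ?normrN ?normr0 ?normr1; lra.
Qed.

(** The distance is 1-Lipschitz, and bounded because a cut sum never exceeds [\sum_j w j]. *)
Lemma mdist_bounded_measurable (y : X) :
  bounded_measurable (fun x : borel_type x0 => mdist (x : X) y).
Proof.
split.
  apply: (@lipschitz_measurable _ _ _ _ 1) => u v; rewrite mul1r ler_norml.
  have := metric_triangle u v y; have := metric_triangle v u y.
  by rewrite (metric_sym v u); lra.
exists (e + \sum_j w j) => x; rewrite ger0_norm ?mdist_ge0//.
have := cut_approx x y; rewrite ler_norml => /andP[_].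
rewrite lerBlDr => /le_trans; apply; rewrite lerD2l; apply: ler_sum => j _.
rewrite ler_piMr//; rewrite !indicE.
by case: (_ \in _); case: (_ \in _) => /=;
  rewrite ?subrr ?subr0 ?sub0r ?normrN ?normr0 ?normr1.
Qed.

(** Since [|d(x, y) - d(x, z)| <= d(y, z)] for every [x], the potential is Lipschitz with the total
    variation as constant. *)
Lemma potential_bounded_measurable : bounded_measurable
  (fun y : borel_type x0 => signed_integral mu (fun x => mdist (x : X) y)).
Proof.
have [M dM] : exists M, forall x y : X, mdist x y <= M.
  (* Passing through [x0] makes the bound uniform in both points. *)
  have [_ [M dM]] := mdist_bounded_measurable x0.
  exists (M + M) => x y; rewrite (le_trans (metric_triangle _ x0 _))//.
  by rewrite lerD// ?(metric_sym x0) (le_trans (ler_norm _)).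
split; last first.
  exists (M * mass_variation mu) => y; apply: signed_integral_le.
    exact: mdist_bounded_measurable.
  by move=> x; rewrite ger0_norm ?mdist_ge0.
apply: (@lipschitz_measurable _ _ _ _ (mass_variation mu)) => y z.
have bz := bounded_measurableZ (-1) (mdist_bounded_measurable z).
rewrite -mulN1r -signed_integralZ; last exact: mdist_bounded_measurable.
rewrite -signed_integralD//; last exact: mdist_bounded_measurable.
rewrite mulrC; apply: signed_integral_le => [|x /=].
  by apply: bounded_measurableD => //; exact: mdist_bounded_measurable.
have := metric_triangle x z y; have := metric_triangle x y z.
by rewrite (metric_sym z y) ler_norml mulN1r; lra.
Qed.

(* Each cut contributes [2 F (1 - F) <= 1/2], where [F] is the mass of its
   side; the error is integrated twice, whence the square. *)
Lemma energy_le_cuts :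
  (energy mu <= (2^-1 * \sum_j w j + e * mass_variation mu ^+ 2)%:E)%E.
Proof.
set G := fun y : borel_type x0 => signed_integral mu (fun x => mdist (x : X) y).
have -> : energy mu = (signed_integral mu G)%:E.
  rewrite -charge_integralE; last exact: potential_bounded_measurable.
  congr charge_integral; apply/funext => y; rewrite /= -charge_integralE//.
  exact: mdist_bounded_measurable.
pose F j := fine (mu (A j)).
(* [S] is the potential of the cut sum, as [G] is that of the metric. *)
pose S y := \sum_j w j * (F j + (1 - 2 * F j) * \1_(A j) y).
have bS : bounded_measurable (fun y => -1 * S y).
  by apply/bounded_measurableZ; exact: bounded_measurable_simple.
have bGS : bounded_measurable (fun y => G y + -1 * S y).
  by apply: bounded_measurableD => //; exact: potential_bounded_measurable.
have GS y : `|G y + -1 * S y| <= e * mass_variation mu.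
  rewrite /= mulN1r.
  have -> : S y = signed_integral mu
      (fun x => \sum_j w j * (\1_(A j) y + (1 - 2 * \1_(A j) y) * \1_(A j) x)).
    rewrite (signed_integral_simple (fun j => \1_(A j) y)).
    by apply: eq_bigr => j _; rewrite -/(F j); ring.
  have bsum := bounded_measurable_simple
    (fun j => \1_(A j) y) (fun j => 1 - 2 * \1_(A j) y).
  rewrite -mulN1r -signed_integralZ//.
  rewrite -signed_integralD//; last 2 first.
  - exact: mdist_bounded_measurable.
  - exact: bounded_measurableZ.
  apply: signed_integral_le => [|x /=].
    apply: bounded_measurableD; first exact: mdist_bounded_measurable.
    exact: bounded_measurableZ.
  by rewrite mulN1r -cutE.
have := signed_integral_le mu bGS GS.
rewrite signed_integralD//; last exact: potential_bounded_measurable.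
rewrite signed_integralZ; last exact: bounded_measurable_simple.
rewrite mulN1r ler_norml => /andP[_ leGS]; rewrite lee_fin expr2 mulrA.
suff : signed_integral mu S <= 2^-1 * \sum_j w j by lra.
rewrite signed_integral_simple mulr_sumr; apply: ler_sum => j _.
rewrite mulrC ler_wpM2r// -/(F j).
(* [2 F (1 - F) <= 1/2] amounts to [(2 F - 1)^2 >= 0], so it holds even when the signed mass [F]
   lies outside [[0, 1]]. *)
by have := sqr_ge0 (2 * F j - 1); rewrite expr2; lra.
Qed.

End cut_energy.

(** * Coordinates and the diameters of the projections *)

Section coordinates.
Context {R : realType} {n : nat} {X : set (l1_space R n)}.
Implicit Types (x y : set_type X) (s : 'I_n).

Definition coord s x : R := coord_proj s (set_val x).

Lemma mdist_coord x y : mdist x y = \sum_s `|coord s x - coord s y|.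
Proof. by apply: eq_bigr => s _; rewrite !mxE. Qed.

Lemma coord_dist_le s x y : `|coord s x - coord s y| <= mdist x y.
Proof. by rewrite mdist_coord (bigD1 s)//= lerDl sumr_ge0. Qed.

Lemma coord_dist_le_diam s x y :
  ((`|coord s x - coord s y|)%:E <=
   metric_diam (set_type (coord_proj s @` X)))%E.
Proof.
have cX (z : set_type X) : (coord_proj s @` X) (coord s z).
  by exists (set_val z) => //; exact: set_valP.
apply: ereal_sup_ubound.
(* The pair is swapped because the metric of [R^o] is [|y - x|]. *)
by exists (SigSub (mem_set (cX y)), SigSub (mem_set (cX x))).
Qed.

(** Coordinates are 1-Lipschitz for the 1-norm. *)
Lemma diam_coord_le s :
  (metric_diam (set_type (coord_proj s @` X)) <= metric_diam (set_type X))%E.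
Proof.
apply: ge_ereal_sup => _ [[u v] _ <-] /=.
have [x Xx xu] := set_valP u; have [y Xy yv] := set_valP v.
pose x' : set_type X := SigSub (mem_set Xx).
pose y' : set_type X := SigSub (mem_set Xy).
apply: (@le_trans _ _ (mdist y' x')%:E).
  rewrite lee_fin; apply: le_trans (coord_dist_le s y' x').
  by rewrite /coord/= xu yv.
by apply: ereal_sup_ubound; exists (y', x').
Qed.

(** An empty supremum would be [-oo]; a point of [X] contributes the distance 0. *)
Lemma diam_coord_ge0 s : X !=set0 ->
  (0 <= metric_diam (set_type (coord_proj s @` X)))%E.
Proof.
move=> [z Xz]; pose x : set_type X := SigSub (mem_set Xz).
by have := coord_dist_le_diam s x x; rewrite subrr normr0.
Qed.

End coordinates.

(** * Cutting each coordinate range along a grid *)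

Section l1_energy.
Context {R : realType} {n : nat} {X : set (l1_space R n)} {x0 : set_type X}.
Variables (mu : {charge set (borel_type x0) -> \bar R}) (D : 'I_n -> R).
Hypotheses (mu1 : mu setT = 1%E)
  (coordD : forall s (x y : set_type X), `|coord s x - coord s y| <= D s).

Lemma coord_range_itv s :
  exists a, forall x : set_type X, a <= coord s x <= a + D s.
Proof.
exists (inf (range (@coord _ _ X s))) => x; apply/andP; split.
  apply: ge_inf; last by exists x.
  exists (coord s x - D s) => _ [y _ <-].
  by have := coordD s x y; rewrite ler_norml; lra.
rewrite -lerBlDr; apply: lb_le_inf; first by exists (coord s x), x.
move=> _ [y _ <-].
by have := coordD s x y; rewrite ler_norml; lra.
Qed.

(** Cut the range of each coordinate [s] at [m + 1] thresholds with mesh [D s / (m + 1)]; the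
    approximation errors of the coordinates add up to at most the sum of the meshes. *)
Lemma energy_le_coord_approx (m : nat) :
  (energy mu <= (2^-1 * (\sum_s D s) +
     m.+1%:R^-1 * ((\sum_s D s) * mass_variation mu ^+ 2))%:E)%E.
Proof.
have [a aD] := choice coord_range_itv.
have D0 s : 0 <= D s by apply: le_trans (coordD s x0 x0).
pose w s := D s / m.+1%:R.
have w0 s : 0 <= w s by rewrite divr_ge0.
have mw s : m.+1%:R * w s = D s by rewrite mulrCA divff ?mulr1.
pose A (j : 'I_n * 'I_m.+1) : set (borel_type x0) :=
  [set x | a j.1 + j.2%:R * w j.1 < coord j.1 x].
have mA j : measurable (A j).
  rewrite -[A j]setTI; have -> : A j =
      (coord j.1 : borel_type x0 -> R) @^-1` `]a j.1 + j.2%:R * w j.1, +oo[.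
    by apply/seteqP; split => x; rewrite /A/= in_itv/= andbT.
  apply: (@lipschitz_measurable _ _ _ _ 1) => // x y.
  by rewrite mul1r coord_dist_le.
have := @energy_le_cuts _ _ _ mu _ A (fun j => w j.1) (\sum_s w s) mA mu1 _ _.
(* The [m + 1] cuts of coordinate [s] have total weight [D s], whatever the mesh. *)
rewrite (_ : \sum_j w j.1 = \sum_s D s); last first.
  rewrite -(pair_bigA _ (fun s (_ : 'I_m.+1) => w s))/=; apply: eq_bigr => s _.
  by rewrite sumr_const card_ord -mulr_natl mw.
rewrite -mulr_suml [_ / _]mulrC -mulrA; apply => [j //|x y].
rewrite mdist_coord.
rewrite -(pair_bigA _ (fun s k =>
  w s * `|\1_(A (s, k)) x - \1_(A (s, k)) y|))/=.
rewrite -sumrB mulr_sumr (le_trans (ler_norm_sum _ _ _))//.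
apply: ler_sum => s _; rewrite [_ * D s]mulrC -/(w s).
have := @staircase_dist R (a s) (w s) m.+1 (coord s x) (coord s y) (w0 s).
rewrite mw => /(_ (aD s x) (aD s y)).
under eq_bigr do rewrite !indicE.
(* Membership in a cut is the comparison counted by the staircase. *)
suff H z (k : 'I_m.+1) : (z \in A (s, k)) = (a s + k%:R * w s < coord s z).
  by under [in X in X -> _]eq_bigr do rewrite -!H.
by apply/idP/idP; rewrite inE.
Qed.

Lemma energy_le_coord : (energy mu <= (2^-1 * \sum_s D s)%:E)%E.
Proof.
apply/lee_addgt0Pr => e e0; set K := (\sum_s D s) * mass_variation mu ^+ 2.
have K0 : 0 <= K.
  rewrite mulr_ge0 ?sqr_ge0// sumr_ge0// => s _.
  by apply: le_trans (coordD s x0 x0).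
(* With [m] the integer part of [K / e], [K / e < m + 1] makes the error at most [e]. *)
apply: le_trans (energy_le_coord_approx (Num.truncn (K / e))) _.
rewrite -EFinD lee_fin lerD2l -/K mulrC ler_pdivrMr// mulrC -ler_pdivrMr//.
exact/ltW/truncnS_gt.
Qed.

End l1_energy.

(** * The two bounds on [M(X)] *)

Local Open Scope ereal_scope.

Theorem theorem4p3 (R : realType) (n : nat) (X : set (l1_space R n))
    (X0 : X !=set0) (cX : compact X) :
  metric_M (set_type X) <=
    (2^-1)%:E * \sum_(s < n) metric_diam (set_type (coord_proj s @` X)) /\
  metric_M (set_type X) <= n%:R%:E * metric_diam (set_type X) * (2^-1)%:E.
Proof.
set D := fun s => metric_diam (set_type (coord_proj s @` X)).
have D0 s : 0 <= D s by exact: diam_coord_ge0.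
have M_le : metric_M (set_type X) <= (2^-1)%:E * \sum_(s < n) D s.
  apply: ge_ereal_sup => _ [x0 [mu [mu1 ->]]].
  (* If the sum is [+oo] the bound is trivial; otherwise each diameter, being nonnegative, is finite
     and the real-valued bound applies. *)
  have [->|] := eqVneq (\sum_(s < n) D s) +oo.
    by rewrite gt0_muley ?leey// lte_fin invr_gt0.
  rewrite -ltey => Dy.
  have Dfin s : D s \is a fin_num.
    rewrite ge0_fin_numE//; apply: le_lt_trans Dy.
    by rewrite (bigD1 s)//= leeDl// sume_ge0.
  have DE : \sum_(s < n) D s = (\sum_(s < n) fine (D s))%:E.
    by rewrite -sumEFin; apply: eq_bigr => s _; rewrite fineK.
  rewrite DE -EFinM; apply: energy_le_coord => // s x y.
  by rewrite -lee_fin fineK// coord_dist_le_diam.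
(* Bound (2) follows from (1) by comparing each of the [n] projections with [X]. *)
split=> //; apply: le_trans M_le _; rewrite muleC lee_wpmul2r ?lee_fin//.
have -> : n%:R%:E * metric_diam (set_type X) =
    \sum_(s < n) metric_diam (set_type X).
  by rewrite mule_natl sumr_const card_ord.
by apply: lee_sum => s _; exact: diam_coord_le.
Qed.
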